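(* Let $n\ge 2$, let $\Phi=\mathsf A_{n-1}=\{e_i-e_j : i,j\in\mathbb Z/n\mathbb Z,\ i\ne j\}$, and let $w=w_{\Phi}$ be the Coxeter element of $W(\Phi)$ given by $e_i\mapsto e_{i+1}$ ($i\in\mathbb Z/n\mathbb Z$). For $q\in(\mathbb Z/n\mathbb Z)^\times$ let $\nu_q\in W(\Phi)$ be given by $\nu_q e_i=e_{qi}$ for all $i \in \mathbb Z/n\mathbb Z$. Then $$\left(\frac{\nu_q}{w}\right)_{\!\Phi}=\operatorname{sgn}^+_n(q)\quad\text{for all } q\in(\mathbb Z/n\mathbb Z)^\times,\qquad\text{and}\qquad \left(\frac{-1}{w}\right)_{\!\Phi}=\operatorname{sgn}^+_n(-1).$$
   Context: $(e_i)_{i\in\mathbb Z/n\mathbb Z}$ is an orthonormal basis of an $n$-dimensional Euclidean space. $\operatorname{sgn}^+_n(q)$ is the sign of the permutation $x\mapsto qx$ of $\mathbb Z/n\mathbb Z$. Set $\Phi_w$ and symbol $\left(\frac{v}{w}\right)_\Phi$: Let $F$ be a separably closed field, $G$ a connected reductive $F$-group and $T$ a maximal torus of $G$ with root system $\Phi=\Phi(G,T)$. An algebraic automorphism of $(G,T)$ is an algebraic automorphism $\theta$ of $G$ preserving $T$; $\bar\theta$ denotes the induced automorphism of $\Phi$. For such $\theta$ put $\Phi_\theta=\{\alpha\in\Phi:$ for all $e\in\mathbb Z$, if $\theta^e\alpha=\alpha$ then $\theta^e$ fixes the root space $\mathrm{Lie}(G)_\alpha$ pointwise$\}$. If $w\in\mathrm{Aut}(\Phi)$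 is elliptic (equivalently, has no nonzero fixed vector in $\mathbb R\Phi$), then $\Phi_w:=\Phi_\theta$ for any algebraic automorphism $\theta$ (of any such $(G,T)$) with $\bar\theta=w$; this is independent of the choice of $\theta$. For $v\in\mathrm{Aut}(\Phi)$ normalising $\langle w\rangle$ (and thus permuting the $w$-orbits in $\Phi_w$), $\left(\frac{v}{w}\right)_\Phi\in\{\pm1\}$ is the sign of the permutation of the orbit set $\langle w\rangle\backslash\Phi_w$ induced by $v$. Here $-1\in\mathrm{Aut}(\Phi)$ is $\alpha\mapsto-\alpha$. *)

(* Defs.v *)
From HB Require Import structures.
From mathcomp Require Import all_boot all_order all_algebra all_fingroup all_field.
From mathcomp Require Import finmap boolp reals.
From mathcomp Require Import mpoly.

Set Implicit Arguments.
Unset Strict Implicit.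
Unset Printing Implicit Defensive.

Import Order.TTheory GRing.Theory Num.Theory.
Local Open Scope ring_scope.

Definition separably_closed (F : fieldType) : Prop :=
  forall p : {poly F}, separable_poly p -> (1 < size p)%N -> exists x, root p x.

(** * Linear algebraic groups over a separably closed field

  Over a separably closed field F, taking F-points identifies smooth closed
  subgroups of an affine algebraic group with the Zariski-closed subgroups of
  its group of F-points.  Every affine algebraic group is a closed subgroup of
  some SL_m (compose an embedding in GL_(m-1) with g |-> diag(g, 1/det g)), so
  a smooth affine F-group is represented by a Zariski-closed subgroup of
  SL_m(F).  As SL_m is closed in the affine space of m x m matrices, regular
  functions on such a group are restrictions of polynomials in the entries. *)

Section LinearGroups.
Variables (F : fieldType) (m : nat).
Implicit Types (Z G T U : 'M[F]_m -> Prop) (p : {mpoly F[m * m]}).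

Definition evalmx p (g : 'M[F]_m) : F := p.@[mxvec g 0].

Definition zariski_closed Z : Prop :=
  exists S : {mpoly F[m * m]} -> Prop,
    forall g, Z g <-> (forall p, S p -> evalmx p g = 0).

Definition vanishes_on p Z : Prop := forall g, Z g -> evalmx p g = 0.

Definition zariski_closure Z (g : 'M[F]_m) : Prop :=
  forall p, vanishes_on p Z -> evalmx p g = 0.

Definition zariski_connected Z : Prop :=
  (exists g, Z g) /\
  forall A B, zariski_closed A -> zariski_closed B ->
    (forall g, Z g -> A g \/ B g) -> (forall g, Z g -> ~ (A g /\ B g)) ->
    (forall g, Z g -> A g) \/ (forall g, Z g -> B g).

Definition linear_group G : Prop :=
  [/\ zariski_closed G,
      forall g, G g -> \det g = 1,
      G 1%:M,
      forall g h, G g -> G h -> G (g *m h)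
    & forall g, G g -> G (invmx g)].

(* Tori over a separably closed field are split. *)
Definition torus T : Prop :=
  [/\ linear_group T, zariski_connected T
    & exists2 P : 'M[F]_m, P \in unitmx &
        forall t, T t -> is_diag_mx (P *m t *m invmx P)].

Definition maximal_torus G T : Prop :=
  [/\ torus T, forall t, T t -> G t
    & forall T', torus T' -> (forall t, T' t -> G t) ->
        (forall t, T t -> T' t) -> forall t, T' t -> T t].

Definition unipotent_mx (u : 'M[F]_m) : Prop :=
  exists k, (u - 1%:M) ^+ k = 0.

Definition trivial_unipotent_radical G : Prop :=
  forall U, linear_group U -> zariski_connected U ->
    (forall u, U u -> unipotent_mx u) ->
    (forall u, U u -> G u) ->
    (forall g u, G g -> U u -> U (g *m u *m invmx g)) ->
    forall u, U u -> u = 1%:M.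

(* The differential at 1 of p, evaluated at the tangent vector X. *)
Definition diff1 p (X : 'M[F]_m) : F :=
  \sum_(k < m * m) evalmx p^`M(k) 1%:M * mxvec X 0 k.

Definition Lie G (X : 'M[F]_m) : Prop :=
  forall p, vanishes_on p G -> diff1 p X = 0.

Definition weight_space G T (chi : 'M[F]_m -> F) (X : 'M[F]_m) : Prop :=
  Lie G X /\ forall t, T t -> t *m X *m invmx t = chi t *: X.

(* Characters are functions whose values off T are irrelevant.  A weight of a
   nonzero vector is automatically a regular character of T. *)
Definition is_root G T (chi : 'M[F]_m -> F) : Prop :=
  (exists t, T t /\ chi t <> 1) /\
  exists X, weight_space G T chi X /\ X <> 0.

Definition polymap (f : 'M[{mpoly F[m * m]}]_m) (g : 'M[F]_m) : 'M[F]_m :=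
  \matrix_(i, j) evalmx (f i j) g.

Definition dpolymap (f : 'M[{mpoly F[m * m]}]_m) (X : 'M[F]_m) : 'M[F]_m :=
  \matrix_(i, j) diff1 (f i j) X.

(* Algebraic automorphisms of (G, T), given with their inverses. *)
Record alg_aut G T := AlgAut {
  aut_poly : 'M[{mpoly F[m * m]}]_m;
  inv_poly : 'M[{mpoly F[m * m]}]_m;
  aut_stab : forall g, G g -> G (polymap aut_poly g);
  inv_stab : forall g, G g -> G (polymap inv_poly g);
  aut_mul : forall g h, G g -> G h ->
    polymap aut_poly (g *m h) = polymap aut_poly g *m polymap aut_poly h;
  autK : forall g, G g -> polymap inv_poly (polymap aut_poly g) = g;
  invK : forall g, G g -> polymap aut_poly (polymap inv_poly g) = g;
  aut_torus : forall t, T t -> T (polymap aut_poly t);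
  inv_torus : forall t, T t -> T (polymap inv_poly t) }.

Definition iterz (X : Type) (f f' : X -> X) (e : int) : X -> X :=
  match e with Posz k => iter k f | Negz k => iter k.+1 f' end.

Variables (G T : 'M[F]_m -> Prop) (theta : alg_aut G T).

Definition aut_iter (e : int) : 'M[F]_m -> 'M[F]_m :=
  iterz (polymap (aut_poly theta)) (polymap (inv_poly theta)) e.

(* Only meaningful on Lie G, where it does not depend on the polynomials
   representing theta and its inverse. *)
Definition daut_iter (e : int) : 'M[F]_m -> 'M[F]_m :=
  iterz (dpolymap (aut_poly theta)) (dpolymap (inv_poly theta)) e.

(* chi \in Phi_theta; theta^e chi is the character chi \o theta^(-e) of T. *)
Definition in_Phi_theta (chi : 'M[F]_m -> F) : Prop :=
  forall e : int,
    (forall t, T t -> chi (aut_iter (- e) t) = chi t) ->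
    forall X, weight_space G T chi X -> daut_iter e X = X.

End LinearGroups.

(* The group of K-points of the base change of G to K. *)
Definition base_change (F K : fieldType) (iota : {rmorphism F -> K}) (m : nat)
    (G : 'M[F]_m -> Prop) : 'M[K]_m -> Prop :=
  zariski_closure (fun h => exists2 g, G g & h = map_mx iota g).

(* Reductivity is geometric: over an imperfect F, triviality of the unipotent
   radical over F itself would only define pseudo-reductive groups. *)
Definition connected_reductive (F : fieldType) (m : nat)
    (G : 'M[F]_m -> Prop) : Prop :=
  [/\ linear_group G, zariski_connected G
    & forall (K : closedFieldType) (iota : {rmorphism F -> K}),
        trivial_unipotent_radical (base_change iota G)].

(** * The set Phi_w and the symbol (v / w)_Phi *)

Section Symbol.
Variables (V : zmodType) (Phi : {fset V}).

(* rho is an isomorphism of Phi onto the root system Phi(G, T).  The last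
   clause says that rho extends to an isomorphism of the root lattices, i.e.
   to a linear isomorphism of their real spans, as all linear relations between
   roots follow from the integral ones. *)
Definition root_system_iso (F : fieldType) (m : nat) (G T : 'M[F]_m -> Prop)
    (rho : Phi -> 'M[F]_m -> F) : Prop :=
  [/\ forall a, is_root G T (rho a),
      forall chi, is_root G T chi ->
        exists a, forall t, T t -> chi t = rho a t
    & forall c : Phi -> int,
        \sum_a val a *~ c a = 0 <->
        forall t, T t -> \prod_a rho a t ^ c a = 1].

(* A pair (G, T) with root system Phi, over a separably closed field. *)
Record group_with_roots := GroupWithRoots {
  gr_field : fieldType;
  gr_dim : nat;
  gr_group : 'M[gr_field]_gr_dim -> Prop;
  gr_torus : 'M[gr_field]_gr_dim -> Prop;
  gr_root : Phi -> 'M[gr_field]_gr_dim -> gr_field;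
  gr_closed : separably_closed gr_field;
  gr_reductive : connected_reductive gr_group;
  gr_maximal : maximal_torus gr_group gr_torus;
  gr_iso : root_system_iso gr_group gr_torus gr_root }.

(* theta induces w on Phi: the character w a is (theta a) = a \o theta^-1. *)
Definition induces (D : group_with_roots)
    (theta : alg_aut (@gr_group D) (@gr_torus D)) (w : {perm Phi}) : Prop :=
  forall (a : Phi) t, gr_torus t ->
    gr_root (w a) t = gr_root a (aut_iter theta (- 1) t).

(* Phi_w.  For elliptic w the set Phi_theta is the same for all (G, T) and all
   theta inducing w, so it is described here as the set of roots that lie in
   Phi_theta for some such choice. *)
Definition Phi_of (w : {perm Phi}) : {set Phi} :=
  [set a | `[< exists (D : group_with_roots)
                 (theta : alg_aut (@gr_group D) (@gr_torus D)),
                 induces theta w /\ in_Phi_theta theta (gr_root a) >]].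

Definition orbits_of (w : {perm Phi}) : {set {set Phi}} :=
  porbit w @: Phi_of w.

(* The sign of the permutation X |-> v @: X of the set of orbits.  restr_perm
   returns the identity when v does not permute the orbits, so v should
   normalise <[w]>. *)
Definition symbol (v w : {perm Phi}) : int :=
  (-1) ^+ odd_perm (restr_perm (orbits_of w) (actperm 'P^* v)).

Definition root_perm_fun (f : V -> V)
    (f_stab : forall x, x \in Phi -> f x \in Phi) (a : Phi) : Phi :=
  [` f_stab _ (valP a)]%fset.

Lemma root_perm_inj f (f_inj : injective f) f_stab :
  injective (@root_perm_fun f f_stab).
Proof. by move=> a b /(congr1 val) /= /f_inj /val_inj. Qed.

Definition root_perm f (f_inj : injective f) f_stab : {perm Phi} :=
  perm (@root_perm_inj f f_inj f_stab).

Lemma root_permE f f_inj f_stab a :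
  val (@root_perm f f_inj f_stab a) = f (val a).
Proof. by rewrite permE. Qed.

End Symbol.

(** * The root system A_(n-1) *)

Section TypeA.
Variables (R : realType) (n : nat).

(* 'Z_n is Z/nZ for 1 < n. *)
Definition euclid := {ffun 'Z_n -> R^o}.

Definition e_ (i : 'Z_n) : euclid := [ffun j => (j == i)%:R].

Definition rootsA : {fset euclid} :=
  [fset e_ x.1 - e_ x.2 | x in [pred x : 'Z_n * 'Z_n | x.1 != x.2]]%fset.

Lemma rootsAP (x : euclid) :
  reflect (exists i j, i != j /\ x = e_ i - e_ j) (x \in rootsA).
Proof.
apply: (iffP (imfsetP _ _ _ _)) => [[[i j] /= ij ->]|[i [j [ij ->]]]].
  by exists i, j.
by exists (i, j).
Qed.

(* The linear automorphism e_i |-> e_(s i). *)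
Definition permute (s : {perm 'Z_n}) (x : euclid) : euclid :=
  [ffun k => x ((s^-1)%g k)].

Lemma permute_is_linear s : linear (permute s).
Proof. by move=> c x y; apply/ffunP => k; rewrite !ffunE. Qed.

Lemma permute_e s i : permute s (e_ i) = e_ (s i).
Proof.
apply/ffunP => k; rewrite !ffunE; congr (_%:R).
by rewrite -(inj_eq (@perm_inj _ s)) permKV.
Qed.

Lemma permuteB s x y : permute s (x - y) = permute s x - permute s y.
Proof. by apply/ffunP => k; rewrite !ffunE. Qed.

Lemma permute_inj s : injective (permute s).
Proof.
move=> x y /ffunP xy; apply/ffunP => k.
by have := xy (s k); rewrite !ffunE permK.
Qed.

Lemma permute_stab s x : x \in rootsA -> permute s x \in rootsA.
Proof.
case/rootsAP => i [j [ij ->]]; apply/rootsAP; exists (s i), (s j).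
by rewrite (inj_eq perm_inj) permuteB !permute_e.
Qed.

Lemma opp_stab x : x \in rootsA -> - x \in rootsA.
Proof.
by case/rootsAP => i [j [ij ->]]; apply/rootsAP; exists j, i; rewrite eq_sym opprB.
Qed.

Definition shift_perm : {perm 'Z_n} := perm (@addIr 'Z_n 1).

Definition mul_perm (q : 'Z_n) (hq : q \is a GRing.unit) : {perm 'Z_n} :=
  perm (mulrI hq).

Definition sgn_plus (q : 'Z_n) (hq : q \is a GRing.unit) : int :=
  (-1) ^+ odd_perm (mul_perm hq).

Definition coxeterA : {perm rootsA} :=
  root_perm (@permute_inj shift_perm) (@permute_stab shift_perm).

Definition nuA (q : 'Z_n) (hq : q \is a GRing.unit) : {perm rootsA} :=
  root_perm (@permute_inj (mul_perm hq)) (@permute_stab (mul_perm hq)).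

Definition oppA : {perm rootsA} := root_perm (@oppr_inj euclid) opp_stab.

(* The symbols (nuA / coxeterA) and (oppA / coxeterA) are well defined:
   coxeterA is elliptic and is normalised by nuA and oppA. *)

Lemma coxeterA_elliptic (c : rootsA -> R) :
  \sum_a c a *: val (coxeterA a) = \sum_a c a *: val a ->
  \sum_a c a *: val a = 0 :> euclid.
Proof.
set x := \sum_a c a *: val a.
have -> : \sum_a c a *: val (coxeterA a) = permute shift_perm x.
  apply/ffunP => k; rewrite !ffunE !sum_ffunE; apply: eq_bigr => a _.
  by rewrite root_permE !ffunE.
move=> xfix.
have x1 k : x (k + 1) = x k.
  by rewrite -{1}xfix ffunE -[k + 1](permE (@addIr 'Z_n 1)) permK.
have x0 k : x k = x 0.
  rewrite -[k]natr_Zp; elim: (nat_of_ord k) => [//|l IH].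
  by rewrite mulrSr x1.
have sx : \sum_k x k = 0.
  under eq_bigr => k _ do rewrite sum_ffunE.
  rewrite exchange_big big1 //= => a _.
  case/rootsAP: (valP a) => i [j [_ ->]].
  under eq_bigr => k _ do rewrite !ffunE.
  rewrite -scaler_sumr sumrB.
  have s1 l : \sum_(k : 'Z_n) (k == l)%:R = 1 :> R.
    by rewrite (bigD1 l) //= eqxx big1 ?addr0 // => k /negbTE ->.
  by rewrite !s1 subrr scaler0.
move: sx; under eq_bigr => k _ do rewrite x0.
rewrite sumr_const => /eqP; rewrite mulrn_eq0 card_ord /= => /eqP xz.
by apply/ffunP => k; rewrite x0 xz ffunE.
Qed.

Lemma nuA_norm q (hq : q \is a GRing.unit) :
  (nuA hq \in 'N(<[coxeterA]>))%g.
Proof.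
have coxX k a : val ((coxeterA ^+ k)%g a) = iter k (permute shift_perm) (val a).
  by elim: k => [|k IH]; rewrite ?expg0 ?perm1 // expgSr permM root_permE IH.
have coxXe k i : iter k (permute shift_perm) (e_ i) = e_ (i + k%:R).
  elim: k => [|k IH]; first by rewrite addr0.
  by rewrite iterS IH permute_e permE /= mulrSr addrA.
have coxXB k x y : iter k (permute shift_perm) (x - y)
    = iter k (permute shift_perm) x - iter k (permute shift_perm) y.
  by elim: k => [//|k IH]; rewrite !iterS IH permuteB.
rewrite inE -cycleJ cycle_subG; apply/cycleP; exists (nat_of_ord q).
apply: (mulgI (nuA hq)); rewrite -conjgC; apply/permP => a; apply: val_inj.
rewrite !permM coxX !root_permE; case/rootsAP: (valP a) => i [j [_ ->]].
rewrite !permuteB !permute_e coxXB !coxXe !permE /=.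
by rewrite natr_Zp !mulrDr !mulr1.
Qed.

Lemma oppA_norm : (oppA \in 'N(<[coxeterA]>))%g.
Proof.
apply: (subsetP (cent_sub _)); rewrite cent_cycle; apply/cent1P.
apply/permP => a; apply: val_inj; rewrite !permM !root_permE.
by apply/ffunP => k; rewrite !ffunE.
Qed.

End TypeA.

(* Main.v *)
Require Import Defs.
From mathcomp Require Import all_boot all_order all_algebra all_fingroup all_field.
From mathcomp Require Import finmap boolp reals ring.
From mathcomp Require Import mpoly.

Set Implicit Arguments.
Unset Strict Implicit.
Unset Printing Implicit Defensive.

Import Order.TTheory GRing.Theory Num.Theory.
Local Open Scope ring_scope.

(** Every root lies in Phi_w.  Take G = SL_n over the algebraic numbers, T the
    diagonal torus, and theta the conjugation by the permutation matrix of the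
    n-cycle: theta^e fixes a root only if n divides e, and then theta^e = 1.
    So the orbits of w in Phi_w are the classes {e_i - e_j : i - j = k} with
    k <> 0 in Z/nZ.  Now nu_q maps the class of k to that of q k, and -1 maps it
    to that of -k, while multiplication by q fixes 0.

    That SL_n is reductive follows from a trace computation: if u and its
    conjugate g u g^-1 by g = 1 + E_ij lie in a group of unipotent matrices,
    then n = tr (u g u g^-1) = tr (u^2) - u_ji^2 = n - u_ji^2; so u is diagonal,
    hence u = 1. *)

(** * Polynomial identities and unipotent matrices *)

Lemma mpoly_ring_ind (R : comNzRingType) (k : nat) (P : {mpoly R[k]} -> Prop) :
  (forall c, P c%:MP_[k]) -> (forall i, P 'X_i) ->
  (forall p q, P p -> P q -> P (p + q)) ->
  (forall p q, P p -> P q -> P (p * q)) -> forall p, P p.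
Proof.
move=> PC PX PD PM; elim/mpolyind => [|c m p _ _ Pp]; first exact: PC.
apply: PD => //; rewrite -mul_mpolyC; apply: (PM) => //.
rewrite mpolyXE_id; apply: (big_ind P) => [||i _]; [exact: PC | exact: PM |].
by elim: (m i) => [|l IH]; rewrite ?expr0 ?exprS; [exact: PC | exact: PM].
Qed.

Lemma poly_eq0_on_infinite (R : numDomainType) (p : {poly R}) :
  (forall x, p.[x] = 0) -> p = 0.
Proof.
move=> p0; apply: (@roots_geq_poly_eq0 _ _ [seq i%:R | i <- iota 0 (size p)]).
- by apply/allP => x _; apply/eqP.
- by rewrite map_inj_uniq ?iota_uniq //; apply: mulrIn; rewrite oner_eq0.
- by rewrite size_map size_iota.
Qed.

Lemma unipotent_diag (F : fieldType) (m : nat) (u : 'M[F]_m) :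
  is_diag_mx u -> unipotent_mx u -> u = 1%:M.
Proof.
case/diag_mxP => d -> [k].
have -> : diag_mx d - 1%:M = diag_mx (\row_i (d 0 i - 1)).
  by apply/matrixP => i j; rewrite !mxE -mulrnBl.
have -> : diag_mx (\row_i (d 0 i - 1)) ^+ k = diag_mx (\row_i (d 0 i - 1) ^+ k).
  elim: k => [|k IH]; first by apply/matrixP => i j; rewrite !mxE.
  rewrite exprS IH -[_ * _]/(_ *m _) mulmx_diag.
  by congr diag_mx; apply/rowP => i; rewrite !mxE exprS.
move/matrixP => dk; apply/matrixP => i j; rewrite !mxE.
have := dk i i; rewrite !mxE eqxx mulr1n => /eqP.
by rewrite expf_eq0 subr_eq0 => /andP[_ /eqP ->].
Qed.

(** The nilpotent matrix [u - 1] has 0 as its only eigenvalue, so over an algebraically closed field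
    its characteristic polynomial is a power of ['X], whose subleading coefficient, minus the trace,
    is 0. *)
Lemma mxtrace_unipotent (K : closedFieldType) (m : nat) (u : 'M[K]_m) :
  unipotent_mx u -> \tr u = m%:R.
Proof.
case: m u => [|m] u [k uk]; first by rewrite [u]flatmx0 mxtrace0.
set N := u - 1%:M in uk.
suff trN : \tr N = 0.
  by rewrite -[u](subrK 1%:M) mxtraceD trN mxtrace1 add0r.
have [r rE] := closed_field_poly_normal (char_poly N).
rewrite (monicP (char_poly_monic N)) scale1r in rE.
have r0 z : z \in r -> z = 0.
  move=> zr; have : root (char_poly N) z by rewrite rE root_prod_XsubC.
  rewrite -eigenvalue_root_char => /eigenvalueP[v vN v0].
  have vNk l : v *m N ^+ l = z ^+ l *: v.
    elim: l => [|l IH]; first by rewrite expr0 mulmx1 scale1r.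
    by rewrite exprSr -[_ * N]/(_ *m N) mulmxA IH -scalemxAl vN scalerA -exprSr.
  have /eqP := vNk k; rewrite uk mulmx0 eq_sym scaler_eq0 (negbTE v0) orbF.
  by rewrite expf_eq0 => /andP[_ /eqP].
apply/eqP; rewrite -oppr_eq0 -char_poly_trace // rE.
rewrite (eq_big_seq (fun=> 'X)) => [|z /r0 ->]; last by rewrite subr0.
rewrite big_const_seq iter_mulr_1.
have := size_char_poly N; rewrite rE size_prod_XsubC => -[sr].
by rewrite count_predT coefXn sr /= ltn_eqF.
Qed.

(** * SL_m and its diagonal torus as linear groups *)

Section Group.
Variables (F : fieldType) (m : nat).

Definition special_linear (g : 'M[F]_m) : Prop := \det g = 1.
Definition diagonal_torus (g : 'M[F]_m) : Prop := is_diag_mx g /\ \det g = 1.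

Definition entry_poly (i j : 'I_m) : {mpoly F[m * m]} := 'X_(mxvec_index i j).
Definition det_poly : {mpoly F[m * m]} := \det (\matrix_(i, j) entry_poly i j).

Lemma evalmx_entry g i j : evalmx (entry_poly i j) g = g i j.
Proof. by rewrite /evalmx mevalXU mxvecE. Qed.

Lemma evalmx_det g : evalmx det_poly g = \det g.
Proof.
rewrite /evalmx -det_map_mx; congr (\det _); apply/matrixP => i j.
by rewrite !mxE -[RHS]evalmx_entry.
Qed.

Lemma evalmxC c (g : 'M[F]_m) : evalmx c%:MP g = c.
Proof. exact: mevalC. Qed.

Lemma linear_group_special_linear : linear_group special_linear.
Proof.
split.
- exists (fun p => p = det_poly - 1) => g; split=> [g1 p ->|/(_ _ erefl)/eqP].
    by rewrite /evalmx mevalB meval1 -/(evalmx _ _) evalmx_det g1 subrr.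
  by rewrite /evalmx mevalB meval1 -/(evalmx _ _) evalmx_det subr_eq0 => /eqP.
- by [].
- exact: det1.
- by move=> g h g1 h1; rewrite /special_linear det_mulmx g1 h1 mulr1.
- by move=> g g1; rewrite /special_linear det_inv g1 invr1.
Qed.

Lemma diag_mx_eq0 (g : 'M[F]_m) i j : is_diag_mx g -> i != j -> g i j = 0.
Proof. by move/is_diag_mxP => gd ij; apply: gd. Qed.

Lemma mulmx_is_diag (g h : 'M[F]_m) :
  is_diag_mx g -> is_diag_mx h -> is_diag_mx (g *m h).
Proof.
by case/diag_mxP => d -> /diag_mxP[e ->]; rewrite mulmx_diag diag_mx_is_diag.
Qed.

Lemma invmx_is_diag (g : 'M[F]_m) :
  is_diag_mx g -> g \in unitmx -> is_diag_mx (invmx g).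
Proof.
case/diag_mxP => d -> du; apply/diag_mxP; exists (\row_i (d 0 i)^-1).
have d0 i : d 0 i != 0.
  by move: du; rewrite unitmxE det_diag unitfE => /prodf_neq0; apply.
rewrite -[RHS]mul1mx -(mulVmx du) -mulmxA mulmx_diag.
rewrite (_ : diag_mx _ = 1%:M) ?mulmx1 //.
by apply/matrixP => i j; rewrite !mxE mulfV.
Qed.

Lemma linear_group_diagonal_torus : linear_group diagonal_torus.
Proof.
split.
- exists (fun p => p = det_poly - 1 \/ exists i j, i != j /\ p = entry_poly i j).
  move=> g; split=> [[gd g1] p [->|[i [j [ij ->]]]]|gS].
  + by rewrite /evalmx mevalB meval1 -/(evalmx _ _) evalmx_det g1 subrr.
  + by rewrite evalmx_entry diag_mx_eq0.
  + split; last first.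
      have /eqP := gS _ (or_introl erefl).
      by rewrite /evalmx mevalB meval1 -/(evalmx _ _) evalmx_det subr_eq0 => /eqP.
    apply/is_diag_mxP => i j ij; rewrite -evalmx_entry; apply: gS.
    by right; exists i, j.
- by move=> g [].
- by split; [exact: scalar_mx_is_diag | exact: det1].
- move=> g h [gd g1] [hd h1]; split; first exact: mulmx_is_diag.
  by rewrite det_mulmx g1 h1 mulr1.
- move=> g [gd g1]; split; last by rewrite det_inv g1 invr1.
  by apply: invmx_is_diag => //; rewrite unitmxE g1 unitr1.
Qed.

End Group.

(** * Zariski connectedness *)

(** Clearing denominators: along a curve whose entries have the common denominator [d], sums and
    products of matrix entries become polynomial in [t] after multiplication by a power of [d]. *)
Lemma evalmx_rational_curve (F : fieldType) (m : nat) (d : {poly F})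
    (v : F -> 'M[F]_m) (p : {mpoly F[m * m]}) :
  (forall i j, exists q : {poly F},
     forall t, d.[t] != 0 -> d.[t] * v t i j = q.[t]) ->
  exists k (q : {poly F}),
    forall t, d.[t] != 0 -> d.[t] ^+ k * evalmx p (v t) = q.[t].
Proof.
move=> vq; elim/mpoly_ring_ind: p => [c|i|p q|p q].
- by exists 0%N, c%:P => t _; rewrite evalmxC hornerC mul1r.
- case/mxvec_indexP: i => i j; have [q qE] := vq i j.
  by exists 1%N, q => t dt; rewrite [evalmx _ _]evalmx_entry expr1 qE.
- move=> [k [p1 pE]] [l [q1 qE]]; exists (k + l)%N, (d ^+ l * p1 + d ^+ k * q1).
  move=> t dt; rewrite /evalmx mevalD hornerD !hornerM !horner_exp -pE // -qE //.
  by rewrite mulrDr exprD !mulrA [d.[t] ^+ l * _]mulrC.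
- move=> [k [p1 pE]] [l [q1 qE]]; exists (k + l)%N, (p1 * q1) => t dt.
  by rewrite /evalmx mevalM hornerM -pE // -qE // exprD mulrACA.
Qed.

(* The set Z is connected as any point g is joined to 1 by the line
   t |-> 1 + t (g - 1), whose first row is divided by the determinant. *)
Lemma zariski_connected_by_lines (F : numFieldType) (m : nat)
    (Z : 'M[F]_m.+1 -> Prop) :
  Z 1%:M -> (forall g, Z g -> \det g = 1) ->
  (forall g D t, Z g -> is_diag_mx D -> \det (D *m (1%:M + t *: (g - 1%:M))) = 1 ->
     Z (D *m (1%:M + t *: (g - 1%:M)))) ->
  zariski_connected Z.
Proof.
move=> Z1 Zdet Zline; split; first by exists 1%:M.
have joined A B g : zariski_closed A -> zariski_closed B ->
    (forall g, Z g -> A g \/ B g) -> (forall g, Z g -> ~ (A g /\ B g)) ->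
    Z g -> A 1%:M -> B g -> False.
  move=> [SA AE] [SB BE] cov disj Zg A1 Bg.
  (* By disjointness some equation [p] of [A] fails at [g] and some equation [q] of [B] fails at
     1. *)
  have [p [Sp pg]] : exists p, SA p /\ evalmx p g <> 0.
    apply: contrapT => np; apply: (disj g Zg); split=> //; apply/AE => p Sp.
    by apply: contrapT => pg; apply: np; exists p.
  have [q [Sq q1]] : exists q, SB q /\ evalmx q 1%:M <> 0.
    apply: contrapT => nq; apply: (disj _ Z1); split=> //; apply/BE => q Sq.
    by apply: contrapT => q1; apply: nq; exists q.
  pose M t := 1%:M + t *: (g - 1%:M).
  pose MX : 'M[{poly F}]_m.+1 := map_mx polyC 1%:M + 'X *: map_mx polyC (g - 1%:M).
  pose d := \det MX.
  have MXE t i j : (MX i j).[t] = M t i j by rewrite !mxE !hornerE.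
  have dE t : d.[t] = \det (M t).
    rewrite -[LHS]/(horner_eval t d) -det_map_mx; congr (\det _).
    by apply/matrixP => i j; rewrite mxE -MXE.
  (* Where [d.[t]] vanishes the inverse defaults to 0; membership of [v t] in [Z] is only claimed
     away from these [t]. *)
  pose D t : 'M[F]_m.+1 := diag_mx (\row_i if i == 0 then d.[t]^-1 else 1).
  pose v t := D t *m M t.
  have Dd t : is_diag_mx (D t) by exact: diag_mx_is_diag.
  have detD t : \det (D t) = d.[t]^-1.
    rewrite det_diag big_ord_recl mxE eqxx big1 ?mulr1 // => i _.
    by rewrite mxE.
  have Zv t : d.[t] != 0 -> Z (v t).
    by move=> dt; apply: Zline => //; rewrite det_mulmx detD -/(M t) -dE mulVf.
  have vE i j : exists r : {poly F},
      forall t, d.[t] != 0 -> d.[t] * v t i j = r.[t].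
    (* Only row 0 of [v t] has a denominator; the other rows are polynomial already and just acquire
       the factor [d]. *)
    exists (if i == 0 then MX i j else d * MX i j) => t dt.
    rewrite [v t]mul_diag_mx mxE [X in _ * (X * _)]mxE -MXE.
    by case: ifP => _; rewrite ?hornerM ?mulVKf ?mul1r.
  have M0 : M 0 = 1%:M by rewrite /M scale0r addr0.
  have M1 : M 1 = g by rewrite /M scale1r addrC subrK.
  have d0 : d.[0] = 1 by rewrite dE M0 det1.
  have d1 : d.[1] = 1 by rewrite dE M1 Zdet.
  have vM t : d.[t] = 1 -> v t = M t.
    move=> dt; rewrite /v (_ : D t = 1%:M) ?mul1mx //.
    by apply/matrixP => i j; rewrite !mxE dt invr1 if_same.
  have [k [p1 pE]] := evalmx_rational_curve p vE.
  have [l [q1' qE]] := evalmx_rational_curve q vE.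
  (* Each [v t] lies in [A] or in [B], so one of [p], [q] vanishes there and the product is zero at
     every [t]. Yet no factor is the zero polynomial: [d] and [q1'] are nonzero at 0, and [p1] is
     nonzero at 1. *)
  have /eqP : d * (p1 * q1') = 0.
    apply: poly_eq0_on_infinite => t; rewrite !hornerM.
    have [->|dt] := eqVneq d.[t] 0; first by rewrite mul0r.
    rewrite -pE // -qE //; have [/AE Av|/BE Bv] := cov _ (Zv t dt).
      by rewrite (Av _ Sp) mulr0 mul0r mulr0.
    by rewrite (Bv _ Sq) !mulr0.
  rewrite !mulf_eq0 => /or3P[] /eqP z.
  - by move/eqP: d0; rewrite z horner0 eq_sym oner_eq0.
  - by apply: pg; have := pE 1;
      rewrite d1 z horner0 vM // M1 expr1n mul1r oner_neq0; apply.
  - by apply: q1; have := qE 0;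
      rewrite d0 z horner0 vM // M0 expr1n mul1r oner_neq0; apply.
(* Whichever of [A] and [B] contains 1 contains all of [Z]; the second case exchanges their
   roles. *)
move=> A B Ac Bc cov disj; have [A1|B1] := cov _ Z1; [left|right] => g Zg.
  by have [//|Bg] := cov _ Zg; case: (joined A B g).
have [Ag|//] := cov _ Zg; case: (joined B A g) => // h Zh.
  by case: (cov _ Zh); [right|left].
by case=> ? ?; case: (disj h).
Qed.

Lemma connected_special_linear (F : numFieldType) (m : nat) :
  zariski_connected (@special_linear F m.+1).
Proof. by apply: zariski_connected_by_lines => //; exact: det1. Qed.

Lemma is_diag_lin (F : fieldType) (m : nat) (t : F) (g h : 'M[F]_m) :
  is_diag_mx g -> is_diag_mx h -> is_diag_mx (g + t *: (h - g)).
Proof.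
move=> gd hd; apply/is_diag_mxP => i j ij; rewrite !mxE.
by rewrite !diag_mx_eq0 // subr0 mulr0 addr0.
Qed.

Lemma connected_diagonal_torus (F : numFieldType) (m : nat) :
  zariski_connected (@diagonal_torus F m.+1).
Proof.
apply: zariski_connected_by_lines => [|g []//|g D t [gd _] Dd ?].
  by split; [exact: scalar_mx_is_diag | exact: det1].
split=> //; apply: mulmx_is_diag => //.
by apply: is_diag_lin => //; exact: scalar_mx_is_diag.
Qed.

(** * Transvections and reductivity of SL_m *)

Section Transvection.
Variables (F : comUnitRingType) (m : nat) (i j : 'I_m).
Hypothesis ij : i != j.

Definition transvection (c : F) : 'M[F]_m := 1%:M + c *: delta_mx i j.

Lemma delta_sqr0 : delta_mx i j *m delta_mx i j = 0 :> 'M[F]_m.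
Proof. by rewrite mul_delta_mx_cond eq_sym (negbTE ij) mulr0n. Qed.

Lemma transvectionM a b :
  transvection a *m transvection b = transvection (a + b).
Proof.
rewrite /transvection mulmxDl mul1mx -scalemxAl mulmxDr mulmx1 -scalemxAr.
by rewrite delta_sqr0 scaler0 addr0 scalerDl addrAC addrA.
Qed.

Lemma invmx_transvection c : invmx (transvection c) = transvection (- c).
Proof.
have cN : transvection c *m transvection (- c) = 1%:M.
  by rewrite transvectionM subrr /transvection scale0r addr0.
have [cu _] := mulmx1_unit cN.
by rewrite -[RHS]mul1mx -(mulVmx cu) -mulmxA cN mulmx1.
Qed.

(** The matrix is triangular with unit diagonal; when [i < j] it is upper triangular and is
    transposed first, since [det_trig] concerns lower triangular matrices. *)
Lemma det_transvection c : \det (transvection c) = 1.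
Proof.
have i0 k : (k == i) && (k == j) = false.
  by apply: contraNF ij => /andP[/eqP <- /eqP <-].
have diag1 k : transvection c k k = 1 by rewrite !mxE eqxx i0 mulr0 addr0.
have [lt_ij|lt_ji|/val_inj eq_ij] := ltngtP i j.
- rewrite -det_tr det_trig; last first.
    apply/is_trig_mxP => k l kl; rewrite !mxE [l == k]gtn_eqF //.
    rewrite add0r (_ : _ && _ = false) ?mulr0 //.
    by apply: contraTF kl => /andP[/eqP -> /eqP ->]; rewrite -leqNgt ltnW.
  by apply: big1 => k _; rewrite mxE.
- rewrite det_trig ?big1 //; apply/is_trig_mxP => k l kl.
  rewrite !mxE [k == l]ltn_eqF //.
  rewrite add0r (_ : _ && _ = false) ?mulr0 //.
  by apply: contraTF kl => /andP[/eqP -> /eqP ->]; rewrite -leqNgt ltnW.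
- by move: (ij); rewrite eq_ij eqxx.
Qed.

Lemma mul_delta_entry (A : 'M[F]_m) k l :
  (A *m delta_mx i j) k l = A k i *+ (l == j).
Proof.
rewrite mxE (bigD1 i) //= big1 ?addr0 => [|h hi]; rewrite mxE ?eqxx ?mulr_natr //.
by rewrite (negbTE hi).
Qed.

Lemma mxtrace_mul_delta (A : 'M[F]_m) : \tr (A *m delta_mx i j) = A j i.
Proof.
rewrite /mxtrace (bigD1 j) //= big1 ?addr0 => [|k kj]; rewrite mul_delta_entry.
  by rewrite eqxx.
by rewrite (negbTE kj).
Qed.

(** Expand the product with E = E_ij: the terms linear in E cancel by cyclicity of the trace, and E
    u E = u_ji E turns the quadratic term into the square of u_ji. *)
Lemma mxtrace_transvection_conj (u : 'M[F]_m) :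
  \tr (u *m (transvection 1 *m u *m transvection (- 1))) =
  \tr (u *m u) - u j i ^+ 2.
Proof.
rewrite /transvection scale1r scaleN1r; set E := delta_mx i j.
have uEuE : \tr (u *m (E *m u *m E)) = u j i ^+ 2.
  rewrite !mulmxA mxtrace_mul_delta mxE (bigD1 j) //= mul_delta_entry eqxx.
  by rewrite big1 ?addr0 // => k kj; rewrite mul_delta_entry (negbTE kj) /= mul0r.
have cyc : \tr (u *m (E *m u)) = \tr (u *m (u *m E)).
  by rewrite mxtrace_mulC -mulmxA mxtrace_mulC -mulmxA.
rewrite mulmxDl mul1mx mulmxDr mulmx1 mulmxN mulmxDr mulmxN mulmxDl mulmxDr.
rewrite !(raddfD, raddfN) /= cyc uEuE.
by rewrite addrA addrK.
Qed.
End Transvection.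

(** Stated for any [G] containing the transvections, so that it applies to a base change of SL_m
    without computing this Zariski closure. *)
Lemma trivial_unipotent_radical_transvections (K : closedFieldType) (m : nat)
    (G : 'M[K]_m -> Prop) :
  (forall i j, i != j -> G (transvection i j 1)) -> trivial_unipotent_radical G.
Proof.
move=> Gtrans U Ugrp _ Uunip _ Unorm u Uu.
apply: unipotent_diag; last exact: Uunip.
apply/is_diag_mxP => j i ji.
have ij : i != j by rewrite eq_sym.
have [_ _ _ UM _] := Ugrp.
pose g : 'M[K]_m := transvection i j 1.
have Uc := Unorm g u (Gtrans _ _ ij) Uu; rewrite invmx_transvection // in Uc.
have := mxtrace_unipotent (Uunip _ (UM _ _ Uu Uc)).
rewrite mxtrace_transvection_conj // (mxtrace_unipotent (Uunip _ (UM _ _ Uu Uu))).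
move/eqP; rewrite subr_eq addrC -subr_eq subrr eq_sym.
by rewrite expf_eq0 => /andP[_ /eqP].
Qed.

Lemma connected_reductive_special_linear (F : numFieldType) (m : nat) :
  connected_reductive (@special_linear F m.+1).
Proof.
split; [exact: linear_group_special_linear|exact: connected_special_linear|].
(* The transvection over [K] is the image of the one over [F], hence lies in the closure of the
   image. *)
move=> K iota; apply: trivial_unipotent_radical_transvections => i j ij p; apply.
exists (transvection i j 1); first exact: det_transvection.
apply/matrixP => k l; rewrite !mxE rmorphD rmorphM rmorph1 /=.
by rewrite !rmorph_nat.
Qed.

(** * Maximality of the diagonal torus *)

Section MaximalTorus.
Variables (F : numFieldType) (m : nat).
Implicit Types (i j k : 'I_m) (t : 'M[F]_m).

(* The cocharacter dual to e_i - e_j, at 2. *)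
Definition coroot2 i j : 'M[F]_m :=
  diag_mx (\row_k if k == i then 2 else if k == j then 2^-1 else 1).

Lemma coroot2E i j k :
  coroot2 i j k k = if k == i then 2 else if k == j then 2^-1 else 1.
Proof. by rewrite !mxE eqxx. Qed.

Lemma coroot2_torus i j : i != j -> diagonal_torus (coroot2 i j).
Proof.
move=> ij; split; first exact: diag_mx_is_diag.
rewrite det_diag (bigD1 i) //= (bigD1 j) ?[j == i]eq_sym //= !mxE !eqxx.
rewrite eq_sym (negbTE ij) big1 ?mulr1 ?mulfV ?pnatr_eq0 // => k /andP[ki kj].
by rewrite mxE (negbTE ki) (negbTE kj).
Qed.

(** All elements of a torus are diagonal in one common basis, and diagonal matrices commute. *)
Lemma torus_mulmxC (U : 'M[F]_m -> Prop) g h : torus U -> U g -> U h ->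
  g *m h = h *m g.
Proof.
move=> [_ _ [P Pu Pd]] Ug Uh.
have gE x : x = invmx P *m (P *m x *m invmx P) *m P.
  by rewrite !mulmxA mulVmx // mul1mx -mulmxA mulVmx // mulmx1.
have /diag_mxP[d dE] := Pd _ Ug; have /diag_mxP[e eE] := Pd _ Uh.
rewrite (gE g) (gE h) dE eE.
have PP (x y : 'M[F]_m) :
    (invmx P *m x *m P) *m (invmx P *m y *m P) = invmx P *m (x *m y) *m P.
  by rewrite !mulmxA -[_ *m P *m invmx P]mulmxA mulmxV // mulmx1.
by rewrite !PP !mulmx_diag; congr (_ *m diag_mx _ *m _);
  apply/rowP => k; rewrite !mxE mulrC.
Qed.

Lemma diagonal_torus_neq0 t i : diagonal_torus t -> t i i != 0.
Proof.
case=> /diag_mxP[d ->]; rewrite det_diag mxE eqxx mulr1n => d1.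
have : \prod_k d 0 k != 0 by rewrite d1 oner_eq0.
by move/prodf_neq0; apply.
Qed.

End MaximalTorus.

Lemma torus_diagonal (F : numFieldType) (m : nat) : torus (@diagonal_torus F m.+1).
Proof.
split; [exact: linear_group_diagonal_torus|exact: connected_diagonal_torus|].
exists 1%:M => [|t [td _]]; first exact: unitmx1.
by rewrite invmx1 mulmx1 mul1mx.
Qed.

(** An element of a larger torus commutes with [coroot2 F i j], whose entries 2 and 1/2 at [i] and
    [j] are distinct in characteristic 0; so its (i, j) entry vanishes. *)
Lemma maximal_torus_diagonal (F : numFieldType) (m : nat) :
  maximal_torus (@special_linear F m.+1) (@diagonal_torus F m.+1).
Proof.
split; [exact: torus_diagonal | by move=> t [] |].
move=> T' T'torus T'G TT' t T't; split; last exact: T'G.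
apply/is_diag_mxP => i j ij.
have := torus_mulmxC T'torus (TT' _ (coroot2_torus F ij)) T't.
rewrite /coroot2 mul_diag_mx mul_mx_diag => /matrixP/(_ i j) /eqP.
rewrite !mxE !eqxx [j == i]eq_sym (negbTE (ij : i != j)) [X in _ == X]mulrC.
rewrite -subr_eq0 -mulrBl mulf_eq0 => /orP[|/eqP //].
have -> : 2 - 2^-1 = 3 / 2 :> F by field.
by rewrite mulf_eq0 invr_eq0 !pnatr_eq0.
Qed.

(** * Root vectors in the Lie algebra *)

Lemma diff1_entry (F : fieldType) (m : nat) (X : 'M[F]_m) i j :
  diff1 (entry_poly F i j) X = X i j.
Proof.
rewrite /diff1 (bigD1 (mxvec_index i j)) //= big1 ?addr0 => [|k kij].
  rewrite /entry_poly mderivX mnm1E eqxx scale1r -[X in (X - _)%MM]add0m addmK.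
  by rewrite mpolyX0 /evalmx meval1 mul1r mxvecE.
rewrite /entry_poly mderivX mnm1E eq_sym (negbTE kij) scale0r.
by rewrite /evalmx meval0 mul0r.
Qed.

Lemma diff1_line (F : fieldType) (m : nat) (p : {mpoly F[m * m]}) (X : 'M[F]_m) :
  exists q : {poly F},
    (forall t, q.[t] = evalmx p (1%:M + t *: X)) /\ q^`().[0] = diff1 p X.
Proof.
elim/mpoly_ring_ind: p => [c|k|p1 p2|p1 p2].
- exists c%:P; split=> [t|]; first by rewrite evalmxC hornerC.
  rewrite derivC horner0 /diff1 big1 // => k _.
  by rewrite mderivC /evalmx meval0 mul0r.
- case/mxvec_indexP: k => i j; exists ((1%:M i j)%:P + X i j *: 'X).
  split=> [t|]; last by rewrite diff1_entry !derivE add0r hornerZ hornerC mulr1.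
  by rewrite evalmx_entry !hornerE !mxE [t * _]mulrC.
- move=> [q1 [q1E q1']] [q2 [q2E q2']]; exists (q1 + q2); split=> [t|].
    by rewrite hornerD q1E q2E /evalmx mevalD.
  rewrite derivD hornerD q1' q2' /diff1 -big_split; apply: eq_bigr => k _.
  by rewrite mderivD /evalmx mevalD mulrDl.
- move=> [q1 [q1E q1']] [q2 [q2E q2']]; exists (q1 * q2); split=> [t|].
    by rewrite hornerM q1E q2E /evalmx mevalM.
  rewrite derivM hornerD !hornerM q1' q2' q1E q2E scale0r addr0 /diff1.
  rewrite mulr_suml mulr_sumr -big_split; apply: eq_bigr => k _ /=.
  by rewrite mderivM /evalmx mevalD !mevalM mulrDl mulrAC mulrA.
Qed.

Lemma Lie_special_linear_delta (F : numFieldType) (m : nat) (i j : 'I_m) :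
  i != j -> Lie (@special_linear F m) (delta_mx i j).
Proof.
move=> ij p p0; have [q [qE <-]] := diff1_line p (delta_mx i j).
rewrite (_ : q = 0) ?deriv0 ?horner0 //; apply: poly_eq0_on_infinite => t.
by rewrite qE; apply: p0; exact: det_transvection.
Qed.

(** * Conjugation by permutation matrices *)

Section PermConj.
Variables (F : fieldType) (m : nat).
Implicit Types (s : {perm 'I_m}) (g : 'M[F]_m).

(** Conjugation by a permutation matrix, written on entries: it only relabels coordinates, hence is
    its own differential. *)
Definition perm_conj s g : 'M[F]_m := \matrix_(i, j) g (s i) (s j).

Definition perm_conj_poly s : 'M[{mpoly F[m * m]}]_m :=
  \matrix_(i, j) entry_poly F (s i) (s j).

Lemma polymap_perm_conj s g : polymap (perm_conj_poly s) g = perm_conj s g.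
Proof. by apply/matrixP => i j; rewrite !mxE evalmx_entry. Qed.

Lemma dpolymap_perm_conj s g : dpolymap (perm_conj_poly s) g = perm_conj s g.
Proof. by apply/matrixP => i j; rewrite !mxE diff1_entry. Qed.

Lemma perm_conj_comp s s' g :
  perm_conj s (perm_conj s' g) = perm_conj (s * s')%g g.
Proof. by apply/matrixP => i j; rewrite !mxE !permM. Qed.

Lemma perm_conj1 g : perm_conj 1%g g = g.
Proof. by apply/matrixP => i j; rewrite !mxE !perm1. Qed.

Lemma perm_conjK s : cancel (perm_conj s) (perm_conj s^-1%g).
Proof. by move=> g; rewrite perm_conj_comp mulVg perm_conj1. Qed.

Lemma perm_conjVK s : cancel (perm_conj s^-1%g) (perm_conj s).
Proof. by move=> g; rewrite perm_conj_comp mulgV perm_conj1. Qed.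

Lemma perm_conjM s g h : perm_conj s (g *m h) = perm_conj s g *m perm_conj s h.
Proof.
apply/matrixP => i j; rewrite !mxE (reindex_inj (@perm_inj _ s)).
by apply: eq_bigr => k _; rewrite !mxE.
Qed.

Lemma det_perm_conj s g : \det (perm_conj s g) = \det g.
Proof.
have -> : perm_conj s g = row_perm s (col_perm s g).
  by apply/matrixP => i j; rewrite !mxE.
rewrite row_permE col_permE !det_mulmx !det_perm mulrCA -signr_addb odd_permV.
by rewrite addbb mulr1.
Qed.

Lemma perm_conj_special_linear s g :
  special_linear g -> special_linear (perm_conj s g).
Proof. by rewrite /special_linear det_perm_conj. Qed.

Lemma perm_conj_diagonal_torus s g :
  diagonal_torus g -> diagonal_torus (perm_conj s g).
Proof.
move=> [gd g1]; split; last by rewrite det_perm_conj.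
apply/is_diag_mxP => i j ij; rewrite mxE diag_mx_eq0 //.
by rewrite (inj_eq perm_inj).
Qed.

(** The automorphism is conjugation for [s^-1]: as characters are composed with the inverse
    automorphism, the root e_i - e_j then goes to e_(s i) - e_(s j). *)
Definition perm_conj_aut s : alg_aut (@special_linear F m) (@diagonal_torus F m).
Proof.
by apply: (@AlgAut _ _ _ _ (perm_conj_poly s^-1%g) (perm_conj_poly s)) => g;
  rewrite ?polymap_perm_conj => *; rewrite ?polymap_perm_conj;
  do ?[exact: perm_conj_special_linear | exact: perm_conj_diagonal_torus
      | exact: perm_conjM | exact: perm_conjK | exact: perm_conjVK].
Defined.

(** The element [c] is the [e]-th power of [s]. Its inverse appears on the Lie algebra because
    characters move by the inverse automorphism. *)
Lemma aut_iter_perm_conj s (e : int) : exists2 c, c \in <[s]>%g &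
  aut_iter (perm_conj_aut s) (- e) =1 perm_conj c /\
  daut_iter (perm_conj_aut s) e =1 perm_conj c^-1%g.
Proof.
have iterE (f : 'M[F]_m -> 'M[F]_m) c k :
    f =1 perm_conj c -> iter k f =1 perm_conj (c ^+ k)%g.
  move=> fE g; elim: k => [|k IH]; first by rewrite perm_conj1.
  by rewrite iterS IH fE perm_conj_comp expgS.
have pE := polymap_perm_conj; have dE := dpolymap_perm_conj.
case: e => k; last first.
  exists (s^-1 ^+ k.+1)%g; first by rewrite groupX // groupV cycle_id.
  split=> g; first exact: (iterE _ _ k.+1 (pE _)).
  by rewrite -expVgn invgK; exact: (iterE _ _ k.+1 (dE _)).
exists (s ^+ k)%g; first exact: mem_cycle.
split=> g; last by rewrite -expVgn; exact: (iterE _ _ k (dE _)).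
(* The opposite of [Posz k] is a [Negz] only for [k] a successor, so 0 is treated apart. *)
case: k => [|k]; first by rewrite oppr0 perm_conj1.
exact: (iterE _ _ k.+1 (pE _)).
Qed.

End PermConj.

(** * The roots of SL_m with respect to the diagonal torus *)

Section DiagonalRoot.
Variables (F : numFieldType) (m : nat).
Implicit Types (i j k l : 'I_m) (t : 'M[F]_m).

Definition diag_root i j t : F := t i i / t j j.

(** The value is 2 to the power of the pairing of e_k - e_l with the coroot of e_i - e_j, and this
    pairing equals 2 only for the root itself. A single torus element thus singles out a root. *)
Lemma diag_root_coroot2 i j k l : i != j ->
  diag_root k l (coroot2 F i j) = 4 -> k = i /\ l = j.
Proof.
move=> ij; rewrite /diag_root !coroot2E.
(* [v h] is twice the diagonal entry at [h], which reduces the claim to an equation in natural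
   numbers. *)
pose v h := if h == i then 4%N else if h == j then 1%N else 2%N.
have vE h : (if h == i then 2 else if h == j then 2^-1 else 1) = (v h)%:R / 2 :> F.
  by rewrite /v; case: ifP => _; [|case: ifP => _]; field.
have v0 h : (v h)%:R != 0 :> F by rewrite pnatr_eq0 /v; case: ifP => // _; case: ifP.
rewrite !vE => E; have /eqP : (v k)%:R = (4 * v l)%:R :> F.
  rewrite natrM -E; field; exact: v0.
rewrite eqr_nat /v; have [->|_] := eqVneq k i; last first.
  by case: (k == j); case: (l == i); case: (l == j).
have [li|_] := eqVneq l i; first by [].
by have [->|] := eqVneq l j.
Qed.

Lemma diag_root_coroot2_eq4 i j : i != j -> diag_root i j (coroot2 F i j) = 4.
Proof.
move=> ij; rewrite /diag_root !coroot2E !eqxx eq_sym (negbTE ij) invrK.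
by ring.
Qed.

(** Conjugation by a diagonal [t] scales the (i, j) entry by t_i / t_j, so one nonzero entry of a
    weight vector determines the weight. *)
Lemma weight_space_entry chi X t i j :
  weight_space (@special_linear F m) (@diagonal_torus F m) chi X ->
  diagonal_torus t -> X i j != 0 -> chi t = diag_root i j t.
Proof.
move=> [_ Xw] tT Xij; have := Xw t tT.
have t0 k := diagonal_torus_neq0 k tT.
have [_ _ _ _ TV] := linear_group_diagonal_torus F m.
have tu : t \in unitmx by rewrite unitmxE (proj2 tT) unitr1.
move/(congr1 (mulmx^~ t)); rewrite mulmxKV //.
have [/diag_mxP[d tE] _] := tT.
have dE k : t k k = d 0 k by rewrite tE mxE eqxx.
rewrite {1 3}tE mul_diag_mx mul_mx_diag => /matrixP/(_ i j).
rewrite !mxE -!dE /diag_root => E.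
by apply: (mulIf Xij); apply: (mulIf (t0 j)); rewrite -E mulrAC divfK.
Qed.

Lemma weight_space_delta i j : i != j ->
  weight_space (@special_linear F m) (@diagonal_torus F m) (diag_root i j)
    (delta_mx i j).
Proof.
move=> ij; split; first exact: Lie_special_linear_delta.
move=> t tT; have t0 k := diagonal_torus_neq0 k tT.
have tu : t \in unitmx by rewrite unitmxE (proj2 tT) unitr1.
apply: (can_inj (mulmxK tu)); rewrite mulmxKV //.
have [/diag_mxP[d tE] _] := tT.
have dE k : t k k = d 0 k by rewrite tE mxE eqxx.
rewrite {1 3}tE mul_diag_mx mul_mx_diag; apply/matrixP => k l.
rewrite !mxE -!dE /diag_root; case: eqP => [->|_]; last by rewrite !mulr0 mul0r.
by case: eqP => [->|_]; rewrite ?mulr0 ?mul0r // !mulr1 divfK.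
Qed.

Lemma is_root_diag i j : i != j ->
  is_root (@special_linear F m) (@diagonal_torus F m) (diag_root i j).
Proof.
move=> ij; split.
  exists (coroot2 F i j); split; first exact: coroot2_torus.
  by rewrite diag_root_coroot2_eq4 // => /eqP; rewrite (eqr_nat _ 4 1).
exists (delta_mx i j); split; first exact: weight_space_delta.
by move/matrixP/(_ i j)/eqP; rewrite !mxE !eqxx oner_eq0.
Qed.

(** A root vector has some nonzero entry, which gives the indices; they differ because a root is a
    nontrivial character. *)
Lemma is_root_diag_inv chi :
  is_root (@special_linear F m) (@diagonal_torus F m) chi ->
  exists i j, i != j /\ forall t, diagonal_torus t -> chi t = diag_root i j t.
Proof.
move=> [[t0 [t0T chi1]] [X [Xw X0]]].
have [i [j Xij]] : exists i j, X i j != 0.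
  apply: contrapT => n; apply: X0; apply/matrixP => i j; rewrite mxE.
  by apply/eqP; apply: contrapT => /negP Xij; apply: n; exists i, j.
have chiE t := @weight_space_entry chi X t i j Xw.
exists i, j; split=> [|t tT]; last exact: chiE.
apply/eqP => ij; apply: chi1; rewrite chiE // /diag_root ij mulfV //.
exact: diagonal_torus_neq0.
Qed.

(** If a power of the automorphism fixes the root, evaluation at [coroot2 F i j] shows that the
    corresponding power of [s] fixes [i]; it is then 1, and so is its action on matrices. *)
Lemma in_Phi_theta_perm_conj (s : {perm 'I_m}) i j : i != j ->
  (forall c, c \in <[s]>%g -> c i = i -> c = 1%g) ->
  in_Phi_theta (perm_conj_aut F s) (diag_root i j).
Proof.
move=> ij sfree e echi X _.
have [c cs [autE dautE]] := aut_iter_perm_conj F s e.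
suff c1 : c = 1%g by rewrite dautE c1 invg1 perm_conj1.
apply: sfree => //.
have := echi _ (coroot2_torus F ij).
rewrite autE diag_root_coroot2_eq4 // /diag_root !mxE => E.
have : diag_root (c i) (c j) (coroot2 F i j) = 4 by rewrite -E /diag_root !mxE.
by case/diag_root_coroot2.
Qed.

End DiagonalRoot.

(** * The root system of SL_n *)

Lemma expz_nat_eq1 (F : numFieldType) (b : nat) (x : int) :
  (1 < b)%N -> (b%:R : F) ^ x = 1 -> x = 0.
Proof.
move=> b1; have bX k : (b%:R : F) ^+ k = 1 -> k = 0%N.
  move=> /eqP; rewrite -natrX (eqr_nat _ _ 1) => /eqP.
  by case: k => // k bk; have := ltn_expl k.+1 b1; rewrite bk ltnS leqn0.
case: x => k; first by move/bX ->.
by rewrite -[_ ^ _]/(_ ^- _) => /(congr1 GRing.inv); rewrite invrK invr1 => /bX.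
Qed.

Section RootsA.
Variables (R : realType) (n : nat).
Local Notation Phi := (rootsA R n).
Local Notation e := (@e_ R n).
Implicit Types (i j k l : 'Z_n) (a : Phi).

Lemma e_E i k : e i k = (k == i)%:R.
Proof. by rewrite ffunE. Qed.

Lemma root_coordE i j k : (e i - e j) k = ((k == i)%:R - (k == j)%:R : int)%:~R.
Proof. by rewrite ffunE [(- _ : euclid _ _) k]ffunE !e_E rmorphB /= !natz. Qed.

Lemma root_inj i j k l : i != j -> e i - e j = e k - e l -> i = k /\ j = l.
Proof.
move=> ij /ffunP E; have := E i; have := E j; rewrite !root_coordE.
move=> /intr_inj Ej /intr_inj; move: Ej; rewrite !eqxx eq_sym (negbTE ij).
by do 4 case: eqP => //.
Qed.

Lemma root_ex a : exists p : 'Z_n * 'Z_n, (p.1 != p.2) && (val a == e p.1 - e p.2).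
Proof.
by have [i [j [ij ->]]] := rootsAP _ (valP a); exists (i, j); rewrite ij eqxx.
Qed.

(** A root is known only as a member of a finite set, so its two indices are recovered by choice;
    [root_inj] makes them unique. *)
Definition src a : 'Z_n := (xchoose (root_ex a)).1.
Definition tgt a : 'Z_n := (xchoose (root_ex a)).2.

Lemma src_neq_tgt a : src a != tgt a.
Proof. by have /andP[] := xchooseP (root_ex a). Qed.

Lemma root_srcE a : val a = e (src a) - e (tgt a).
Proof. by have /andP[_ /eqP] := xchooseP (root_ex a). Qed.

Lemma mem_rootsA i j : i != j -> e i - e j \in Phi.
Proof. by move=> ij; apply/rootsAP; exists i, j. Qed.

Definition mkroot i j (ij : i != j) : Phi := [` mem_rootsA ij]%fset.

Lemma mkrootE i j (ij : i != j) : src (mkroot ij) = i /\ tgt (mkroot ij) = j.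
Proof.
by have [<- <-] := root_inj ij (root_srcE (mkroot ij)).
Qed.

Lemma permute_root s i j : permute s (e i - e j) = e (s i) - e (s j).
Proof. by rewrite permuteB !permute_e. Qed.

Lemma coxeterA_srcE a :
  src (coxeterA R n a) = src a + 1 /\ tgt (coxeterA R n a) = tgt a + 1.
Proof.
have := root_srcE (coxeterA R n a); rewrite root_permE root_srcE permute_root.
by rewrite !permE => /root_inj[|<- <- //]; rewrite (inj_eq (@addIr _ _)) src_neq_tgt.
Qed.

(** * The isomorphism of A_(n-1) with the roots of SL_n *)

Section Isomorphism.
Variable F : numFieldType.
Local Notation SL := (@special_linear F (Zp_trunc n).+2).
Local Notation T := (@diagonal_torus F (Zp_trunc n).+2).

(** The type ['Z_n] consists of the ordinals below [(Zp_trunc n).+2], so the indices of roots serve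
    directly as matrix indices. *)
Definition rhoA a : 'M[F]_((Zp_trunc n).+2) -> F := diag_root (src a) (tgt a).

Definition coord a k : int := (k == src a)%:R - (k == tgt a)%:R.

Lemma sum_coord a : \sum_k coord a k = 0.
Proof.
have s1 l : \sum_(k : 'Z_n) (k == l)%:R = 1 :> int.
  by rewrite (bigD1 l) //= eqxx big1 ?addr0 // => k /negbTE ->.
by rewrite sumrB !s1 subrr.
Qed.

Lemma rhoAE a t : T t -> rhoA a t = \prod_k t k k ^ coord a k.
Proof.
move=> tT; have t0 k := diagonal_torus_neq0 k tT.
have delta l : \prod_k t k k ^ (k == l)%:R = t l l.
  by rewrite (bigD1 l) //= eqxx big1 ?mulr1 // => k /negbTE ->.
rewrite /rhoA /diag_root -(delta (src a)) -(delta (tgt a)) -prodfV -big_split.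
by apply: eq_bigr => k _; rewrite /= /coord expfzDr // invr_expz.
Qed.

Definition comb_coord (c : Phi -> int) k : int := \sum_a coord a k * c a.

Lemma sum_comb_coord c : \sum_k comb_coord c k = 0.
Proof.
rewrite exchange_big big1 // => a _.
by rewrite -mulr_suml sum_coord mul0r.
Qed.

Lemma comb_rootE c k : (\sum_a val a *~ c a : euclid R n) k = (comb_coord c k)%:~R.
Proof.
have mulzE (x : euclid R n) (z : int) : (x *~ z) k = x k *~ z.
  by case: z => l; rewrite ?NegzE ?mulrNz ?ffunE -!pmulrn ffunMnE.
rewrite sum_ffunE rmorph_sum; apply: eq_bigr => a _ /=.
by rewrite mulzE rmorphM /= -root_coordE -root_srcE mulrzr.
Qed.

Lemma prod_rhoAE c t : T t ->
  \prod_a rhoA a t ^ c a = \prod_k t k k ^ comb_coord c k.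
Proof.
move=> tT; have t0 k := diagonal_torus_neq0 k tT.
have prodX (b : int) I (r : seq I) (f : I -> F) :
    (\prod_(x <- r) f x) ^ b = \prod_(x <- r) f x ^ b.
  by apply: (big_morph (fun x : F => x ^ b)) => [x y|]; rewrite ?expfzMl ?exp1rz.
under eq_bigr => a _ do rewrite rhoAE // prodX.
rewrite exchange_big; apply: eq_bigr => k _ /=.
rewrite (big_morph (fun x : int => t k k ^ x) (id1 := 1) (op1 := *%R)) => [|x y|].
- by apply: eq_bigr => a _; rewrite exprz_exp.
- by rewrite expfzDr.
- by rewrite expr0z.
Qed.

(** For the last clause, both relations amount to the vanishing of all [comb_coord c k]. On the
    character side the torus only shows that these integers are all equal, and their sum being 0
    then makes them 0. *)
Lemma root_system_iso_rhoA : root_system_iso SL T rhoA.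
Proof.
split=> [a|chi /is_root_diag_inv[i [j [ij chiE]]]|c].
- exact/is_root_diag/src_neq_tgt.
- exists (mkroot ij) => t tT; rewrite chiE // /rhoA.
  by have [-> ->] := mkrootE ij.
have -> : \sum_a val a *~ c a = 0 <-> forall k, comb_coord c k = 0.
  split=> [E k|E]; last by apply/ffunP => k; rewrite comb_rootE E ffunE.
  by apply: (@intr_inj R); rewrite -comb_rootE E ffunE.
split=> [E t tT|E k].
  by rewrite prod_rhoAE // big1 // => k _; rewrite E expr0z.
(* On [coroot2 F i j] the product of characters is 2 to the power of the difference of the two
   coordinates. *)
have const i j : comb_coord c i = comb_coord c j.
  have [->//|ij] := eqVneq i j.
  have := E _ (coroot2_torus F ij); rewrite (prod_rhoAE _ (coroot2_torus F ij)).
  rewrite (bigD1 i) //= (bigD1 j) ?[j == i]eq_sym //= !coroot2E !eqxx eq_sym.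
  rewrite (negbTE ij) big1 => [|l /andP[li lj]]; last first.
    by rewrite coroot2E (negbTE li) (negbTE lj) exp1rz.
  rewrite mulr1 exprz_inv -expfzDr ?pnatr_eq0 // => /expz_nat_eq1 E2.
  by apply/eqP; rewrite -subr_eq0 E2.
have := sum_comb_coord c; under eq_bigr => l _ do rewrite (const l k).
by rewrite sumr_const card_ord => /eqP; rewrite mulrn_eq0 => /eqP.
Qed.

End Isomorphism.

Lemma separably_closed_algC : separably_closed algC.
Proof. by move=> p _ p1; apply/closed_rootP; rewrite gtn_eqF. Qed.

Definition SL_with_roots : group_with_roots Phi :=
  GroupWithRoots separably_closed_algC
    (connected_reductive_special_linear algC (Zp_trunc n).+1)
    (maximal_torus_diagonal algC (Zp_trunc n).+1)
    (root_system_iso_rhoA algC).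

(** * The set Phi_w of the Coxeter element *)

Lemma shift_permX (k : nat) i : ((shift_perm n ^+ k)%g i) = i + k%:R.
Proof.
elim: k => [|k IH]; first by rewrite perm1 addr0.
by rewrite expgSr permM IH permE mulrSr addrA.
Qed.

Lemma Phi_of_coxeterA : Phi_of (coxeterA R n) = [set: Phi].
Proof.
apply/setP => a; rewrite !inE; apply/asboolP.
(* One group and one automorphism suffice, since [Phi_of] asks only for some choice. *)
exists SL_with_roots, (perm_conj_aut algC (shift_perm n)); split.
  move=> b t _ /=; have [sE tE] := coxeterA_srcE b.
  by rewrite /rhoA sE tE /diag_root /aut_iter /= polymap_perm_conj !mxE !permE.
apply: in_Phi_theta_perm_conj; first exact: src_neq_tgt.
(* A translation of Z/nZ with a fixed point is the identity. *)
move=> c /cycleP[k ->]; rewrite shift_permX => /eqP.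
rewrite -subr_eq0 [_ + k%:R]addrC addrK => /eqP k0.
by apply/permP => j; rewrite shift_permX k0 addr0 perm1.
Qed.

End RootsA.

(** * Signs *)

(** The injection [h] carries a factorisation of [s] into transpositions to one of [s']. It serves
    to compare a permutation of Z/nZ with one of the sets of roots. *)
Lemma odd_perm_inj_transport (T T' : finType) (h : T -> T') (s : {perm T})
    (s' : {perm T'}) :
  injective h -> (forall x, s' (h x) = h (s x)) ->
  (forall y, y \notin codom h -> s' y = y) -> odd_perm s' = odd_perm s.
Proof.
move=> h_inj s'h s'out; have [ts sE _] := prod_tpermP s.
pose lift (us : seq (T * T)) := (\prod_(t <- us) tperm (h t.1) (h t.2))%g.
have lift_h us x : lift us (h x) = h ((\prod_(t <- us) tperm t.1 t.2)%g x).
  rewrite /lift; elim: us x => [|t us IH] x; first by rewrite !big_nil !perm1.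
  by rewrite !big_cons !permM -inj_tperm ?IH.
have lift_out us y : y \notin codom h -> lift us y = y.
  move=> yh; rewrite /lift; elim: us => [|t us IH]; first by rewrite big_nil perm1.
  by rewrite big_cons permM tpermD ?IH //; apply: contraNneq yh => <-; apply: codom_f.
have -> : s' = lift ts.
  apply/permP => y; have [/codomP[x ->]|yh] := boolP (y \in codom h).
    by rewrite s'h lift_h -sE.
  by rewrite s'out // lift_out.
rewrite sE /lift; elim: ts {sE} => [|t us IH]; first by rewrite !big_nil !odd_perm1.
by rewrite !big_cons !odd_permM IH !odd_tperm (inj_eq h_inj).
Qed.

(** * Orbits of the Coxeter element and the two symbols *)

Section Symbols.
Variables (R : realType) (n : nat).
Local Notation Phi := (rootsA R n).
Local Notation e := (@e_ R n).
Local Notation w := (coxeterA R n).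
Implicit Types (i j k l : 'Z_n) (a b : Phi).

Definition diff_root a : 'Z_n := src a - tgt a.
(** For nonzero [k] this is an orbit of the Coxeter element; for [k = 0] it is empty. *)
Definition diff_class k : {set Phi} := [set a | diff_root a == k].

Lemma root_eq a b : src a = src b -> tgt a = tgt b -> a = b.
Proof. by move=> ss tt; apply: val_inj; rewrite /= !root_srcE ss tt. Qed.

Lemma coxeterA_expE (k : nat) a :
  src ((w ^+ k)%g a) = src a + k%:R /\ tgt ((w ^+ k)%g a) = tgt a + k%:R.
Proof.
elim: k => [|k [IHs IHt]]; first by rewrite perm1 !addr0.
rewrite expgSr permM; have [-> ->] := coxeterA_srcE ((w ^+ k)%g a).
by rewrite IHs IHt mulrSr !addrA.
Qed.

(** The Coxeter element translates both indices by 1 and so keeps their difference. Conversely, two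
    roots with the same difference are translates by the difference of their sources. *)
Lemma porbit_coxeterA a : porbit w a = diff_class (diff_root a).
Proof.
apply/setP => b; rewrite inE; apply/porbitP/eqP => [[k ->]|E].
  have [sE tE] := coxeterA_expE k a.
  by rewrite /diff_root sE tE opprD addrACA subrr addr0.
exists (src b - src a : 'Z_n); apply: root_eq.
  by rewrite (proj1 (coxeterA_expE _ a)) natr_Zp addrC subrK.
rewrite (proj2 (coxeterA_expE _ a)) natr_Zp.
have : src b = diff_root a + tgt b by rewrite -E subrK.
by move=> ->; rewrite /diff_root; ring.
Qed.

Lemma diff_root_neq0 a : diff_root a != 0.
Proof. by rewrite subr_eq0 src_neq_tgt. Qed.

Lemma diff_class_ex k : k != 0 -> exists a, diff_root a = k.
Proof.
move=> k0; exists (mkroot R k0); rewrite /diff_root.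
by have [-> ->] := mkrootE R k0; rewrite subr0.
Qed.

Lemma orbits_of_coxeterA : orbits_of w = diff_class @: [set~ 0].
Proof.
rewrite /orbits_of Phi_of_coxeterA; apply/setP => X.
apply/imsetP/imsetP => [[a _ ->]|[k]].
  by exists (diff_root a); rewrite ?porbit_coxeterA // !inE diff_root_neq0.
rewrite !inE => /diff_class_ex[a ak] ->; exists a => //.
by rewrite porbit_coxeterA ak.
Qed.

(** Injectivity includes 0, whose class is empty while all others are not; so all of Z/nZ embeds
    into the sets of roots. *)
Lemma diff_class_inj : injective diff_class.
Proof.
have sub k l : k != 0 -> diff_class k = diff_class l -> k = l.
  move=> /diff_class_ex[a ak] /setP/(_ a).
  by rewrite !inE ak eqxx => /esym/eqP.
move=> k l E; have [k0|k0] := eqVneq k 0; last exact: sub.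
by have [->|l0] := eqVneq l 0; last by apply/esym/sub.
Qed.

(** Treats nu_q and -1 together: [v] permutes the classes as multiplication by [q] permutes Z/nZ.
    The extra point 0 is fixed by the multiplication, and its empty class is not an orbit, so the
    signs agree. *)
Lemma symbol_coxeterA (v : {perm Phi}) (q : 'Z_n) (hq : q \is a GRing.unit) :
  (forall a, diff_root (v a) = q * diff_root a) -> symbol v w = sgn_plus hq.
Proof.
move=> vq; rewrite /symbol /sgn_plus; congr (_ ^+ nat_of_bool _).
have vclass k : v @: diff_class k = diff_class (q * k).
  apply/setP => b; rewrite -[b](permKV v) mem_imset; last exact: perm_inj.
  by rewrite !inE vq (inj_eq (mulrI hq)).
have actE X : actperm 'P^* v X = v @: X by rewrite actpermE.
have orbE k : (diff_class k \in orbits_of w) = (k != 0).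
  by rewrite orbits_of_coxeterA (mem_imset _ _ diff_class_inj) !inE.
(* Without this stability [restr_perm] would default to the identity. *)
have stab : actperm 'P^* v \in ('N(orbits_of w | 'P))%g.
  rewrite !inE; apply/subsetP => X; rewrite {1}orbits_of_coxeterA.
  case/imsetP=> k; rewrite !inE => k0 ->.
  by rewrite /= apermE actE vclass orbE mulrI_eq0 //; apply: mulrI.
apply: (odd_perm_inj_transport diff_class_inj) => [k|X Xout].
  (* At [k = 0] the class lies outside the orbit set, where the restricted permutation is the
     identity. *)
  rewrite [mul_perm hq k]permE; have [->|k0] := eqVneq k 0.
    by rewrite mulr0 (out_perm (restr_perm_on _ _)) // orbE eqxx.
  by rewrite restr_permE ?orbE // actE vclass.
rewrite (out_perm (restr_perm_on _ _)) //; apply: contra Xout.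
by rewrite orbits_of_coxeterA => /imsetP[k _ ->]; apply: codom_f.
Qed.

Lemma diff_root_nuA (q : 'Z_n) (hq : q \is a GRing.unit) a :
  diff_root (nuA R hq a) = q * diff_root a.
Proof.
have := root_srcE (nuA R hq a); rewrite root_permE root_srcE permute_root !permE.
rewrite /diff_root mulrBr => /root_inj[|-> -> //].
by rewrite (inj_eq (mulrI hq)) src_neq_tgt.
Qed.

Lemma diff_root_oppA a : diff_root (oppA R n a) = -1 * diff_root a.
Proof.
have := root_srcE (oppA R n a); rewrite root_permE root_srcE opprB.
rewrite /diff_root mulN1r opprB => /root_inj[|-> -> //].
by rewrite eq_sym src_neq_tgt.
Qed.

End Symbols.

Theorem mainTheorem2 (R : realType) (n : nat) (hn : (1 < n)%N) :
  (forall (q : 'Z_n) (hq : q \is a GRing.unit),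
     symbol (nuA R hq) (coxeterA R n) = sgn_plus hq) /\
  symbol (oppA R n) (coxeterA R n) = sgn_plus (unitrN1 'Z_n).
Proof.
split=> [q hq|]; apply: symbol_coxeterA => a.
  exact: diff_root_nuA.
exact: diff_root_oppA.
Qed.
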